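(* Let $m,n\geq 2$. Then: (i) If $\hat g_{\text{inv}}:\mathbb{C}^{m\times n}\to\mathbb{C}^{n\times m}$ is any function with $\sup_{A\in\mathbb{C}^{m\times n},\,\|A\|_F\le\sqrt2}\|A^\dagger-\hat g_{\text{inv}}(A)\|_F<\infty$, then $\hat g_{\text{inv}}$ is not Banach-Mazur computable. (ii) If $\hat g_{\text{norm}}:\mathbb{C}^{m\times n}\to\mathbb{R}$ is any function with $\sup_{A\in\mathbb{C}^{m\times n},\,\|A\|_F\le\sqrt2}\big|\|A^\dagger\|_F-\hat g_{\text{norm}}(A)\big|<\infty$, then $\hat g_{\text{norm}}$ is not Banach-Mazur computable. (iii) If $\hat\Psi_{\text{lsq}}:\mathbb{C}^{m\times n}\times\mathbb{C}^m\to\mathbb{R}$ is any function with $\sup_{(A,b):\,\|A\|_F\le\sqrt2,\ \|b\|_2\le\sqrt2}\big|\min_{x\in\mathbb{C}^n}\|Ax-b\|_2-\hat\Psi_{\text{lsq}}(A,b)\big|<\tfrac14$, then $\hat\Psi_{\text{lsq}}$ is not Banach-Mazur computable. (iv) If $\hat\Psi_{\text{sol}}:\mathbb{C}^{m\times n}\times\mathbb{C}^m\to\mathbb{C}^n$ is any function with $\sup_{(A,b):\,\|A\|_F\le\sqrt2,\ \|b\|_2\le\sqrt2}\|A^\dagger b-\hat\Psi_{\text{sol}}(A,b)\|_2<\infty$, then $\hat\Psi_{\text{sol}}$ is not Banach-Mazur computable. (v) If $\hat\Psi_{\text{norm}}:\mathbb{C}^{m\times n}\times\mathbb{C}^m\to\mathbb{R}$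 is any function with $\sup_{(A,b):\,\|A\|_F\le\sqrt2,\ \|b\|_2\le\sqrt2}\big|\|A^\dagger b\|_2-\hat\Psi_{\text{norm}}(A,b)\big|<\infty$, then $\hat\Psi_{\text{norm}}$ is not Banach-Mazur computable. (vi) If $\hat\kappa:\mathbb{C}^{m\times n}\to\mathbb{R}$ is any function with $\sup_{A\in\mathbb{C}^{m\times n},\,\|A\|_F\le\sqrt2}\big|\|A\|_F\|A^\dagger\|_F-\hat\kappa(A)\big|<\infty$, then $\hat\kappa$ is not Banach-Mazur computable.
   Context: For $A\in\mathbb{C}^{m\times n}$, $A^\dagger\in\mathbb{C}^{n\times m}$ denotes the Moore–Penrose pseudoinverse (the unique matrix with $AA^\dagger A=A$, $A^\dagger AA^\dagger=A^\dagger$, $(AA^\dagger)^H=AA^\dagger$, $(A^\dagger A)^H=A^\dagger A$); $A^\dagger b$ is the minimal-Euclidean-norm minimizer of $\|Ax-b\|_2$. $\|\cdot\|_F$ is the Frobenius norm and $\|\cdot\|_2$ the Euclidean norm. Computability notions: a sequence $(r_k)\subset\mathbb{Q}$ is computable if $r_k=(-1)^{s(k)}a(k)/b(k)$ for recursive $a,b,s:\mathbb{N}\to\mathbb{N}$, $b(k)\ne0$ (analogously for multi-indexed sequences). A real $x$ is computable if there is a computable rational sequence $(r_k)$ with $|r_k-x|\le 2^{-k}$ for all $k$. A real sequence $(x_n)$ is computable if there is a computable rational double sequence $(r_{n,k})$ with $|r_{n,k}-x_n|\le2^{-k}$ for all $n,k$. Complex numbers, vectors, matrices and sequences thereof are computable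 if all real and imaginary parts of all entries are. A function defined on computable inputs is Banach-Mazur computable if it maps every computable sequence of inputs to a computable sequence of outputs (for complex-valued functions: the real and imaginary parts do). *)

(* Defs.v *)
From mathcomp Require Import all_boot all_algebra.
From mathcomp Require Import all_classical all_reals.
From mathcomp Require Import complex.

Set Implicit Arguments.
Unset Strict Implicit.
Unset Printing Implicit Defensive.

Import GRing.Theory Num.Theory.
Local Open Scope ring_scope.

Inductive rcode : Type :=
| RZero : rcode
| RSucc : rcode
| RProj : nat -> rcode
| RComp : rcode -> list rcode -> rcode
| RPrec : rcode -> rcode -> rcode
| RMin  : rcode -> rcode.

Inductive reval : rcode -> list nat -> nat -> Prop :=
| re_zero v : reval RZero v 0
| re_succ v : reval RSucc v (S (nth 0%N v 0))
| re_proj i v : reval (RProj i) v (nth 0%N v i)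
| re_comp f gs v w y :
    revals gs v w -> reval f w y -> reval (RComp f gs) v y
| re_prec0 f g v y : reval f v y -> reval (RPrec f g) (0%N :: v) y
| re_precS f g n v z y :
    reval (RPrec f g) (n :: v) z -> reval g (n :: z :: v) y ->
    reval (RPrec f g) (S n :: v) y
| re_min f v n :
    reval f (n :: v) 0 ->
    (forall k, (k < n)%N -> exists y, reval f (k :: v) (S y)) ->
    reval (RMin f) v n
with revals : list rcode -> list nat -> list nat -> Prop :=
| res_nil v : revals nil v nil
| res_cons g gs v y w :
    reval g v y -> revals gs v w -> revals (g :: gs) v (y :: w).

Definition recursive1 (a : nat -> nat) : Prop :=
  exists c : rcode, forall k, reval c [:: k] (a k).
Definition recursive2 (a : nat -> nat -> nat) : Prop :=
  exists c : rcode, forall n k, reval c [:: n; k] (a n k).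

Section Computability.
Variable R : realType.

Definition ratval (s a b : nat) : R :=
  (-1) ^+ s * a%:R / b%:R.

Definition computable_seq (x : nat -> R) : Prop :=
  exists a b s : nat -> nat -> nat,
    [/\ recursive2 a, recursive2 b, recursive2 s,
        (forall n k, b n k <> 0%N) &
        forall n k, `| ratval (s n k) (a n k) (b n k) - x n | <= (2 ^+ k)^-1].

Definition computable_mx_seq (p q : nat) (A : nat -> 'M[R[i]]_(p, q)) : Prop :=
  forall i j, computable_seq (fun k => complex.Re (A k i j)) /\
              computable_seq (fun k => complex.Im (A k i j)).

Definition BM_mx_mx (m n p q : nat) (g : 'M[R[i]]_(m, n) -> 'M[R[i]]_(p, q))
  : Prop :=
  forall A : nat -> 'M[R[i]]_(m, n),
    computable_mx_seq A -> computable_mx_seq (fun k => g (A k)).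

Definition BM_mx_real (m n : nat) (g : 'M[R[i]]_(m, n) -> R) : Prop :=
  forall A : nat -> 'M[R[i]]_(m, n),
    computable_mx_seq A -> computable_seq (fun k => g (A k)).

Definition BM_mxvec_real (m n : nat) (g : 'M[R[i]]_(m, n) -> 'cV[R[i]]_m -> R)
  : Prop :=
  forall (A : nat -> 'M[R[i]]_(m, n)) (b : nat -> 'cV[R[i]]_m),
    computable_mx_seq A -> computable_mx_seq b ->
    computable_seq (fun k => g (A k) (b k)).

Definition BM_mxvec_vec (m n : nat)
  (g : 'M[R[i]]_(m, n) -> 'cV[R[i]]_m -> 'cV[R[i]]_n) : Prop :=
  forall (A : nat -> 'M[R[i]]_(m, n)) (b : nat -> 'cV[R[i]]_m),
    computable_mx_seq A -> computable_mx_seq b ->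
    computable_mx_seq (fun k => g (A k) (b k)).

Definition csqnorm (z : R[i]) : R := complex.Re z ^+ 2 + complex.Im z ^+ 2.

Definition frob_norm (p q : nat) (A : 'M[R[i]]_(p, q)) : R :=
  Num.sqrt (\sum_(i < p) \sum_(j < q) csqnorm (A i j)).

Definition vnorm (p : nat) (v : 'cV[R[i]]_p) : R := frob_norm v.

Definition ctrmx (p q : nat) (A : 'M[R[i]]_(p, q)) : 'M[R[i]]_(q, p) :=
  (map_mx (@conjc R) A)^T.

Definition penrose (m n : nat) (A : 'M[R[i]]_(m, n)) (X : 'M[R[i]]_(n, m))
  : Prop :=
  [/\ A *m X *m A = A, X *m A *m X = X,
      ctrmx (A *m X) = A *m X & ctrmx (X *m A) = X *m A].

Definition mp_pinv (m n : nat) (A : 'M[R[i]]_(m, n)) : 'M[R[i]]_(n, m) :=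
  xget 0 [set X | penrose A X].

Definition lsq_res (m n : nat) (A : 'M[R[i]]_(m, n)) (b : 'cV[R[i]]_m) : R :=
  inf [set r | exists x : 'cV[R[i]]_n, r = vnorm (A *m x - b)].

End Computability.

(* Main.v *)
Require Import Defs.
From mathcomp Require Import all_boot all_algebra.
From mathcomp Require Import all_classical all_reals.
From mathcomp Require Import complex.
From mathcomp Require Import all_order zify lra ring.
Import GRing.Theory Num.Theory Order.TTheory.
Local Open Scope ring_scope.

(** A sequence [x] of computable reals in [0, 1] can be built from any recursive [h] so that
    [x n = 2 ^ -t0], where [t0] is the least zero of [h n], and [x n = 0] when [h n] has no zero.
    For [A = diag(1, x n, 0, ...)] and [b = e_2] the quantities in (i), (ii) and (iv)-(vi) are
    within a constant of [1 / x n] (with [1 / 0 = 0]), so a computable bounded-error approximation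
    bounds [t0] recursively, and a bounded search decides whether [h n] has a zero; the residual
    in (iii) is 1 or 0 according to whether [x n = 0], so an error below 1/4 decides this as well.
    Hence every Sigma_1 set would be recursive. Then recursive predicates would be closed under
    quantification, so the evaluation relation of [rcode], which is first-order definable through
    coded derivations, would be recursive, and diagonalization gives a contradiction. *)

(** * Recursive functions and an undecidable Sigma_1 set *)

Local Open Scope nat_scope.

(** Programs carry no arity and read missing arguments as 0, so [k] fixes the length of the
    admissible inputs. Working with functions of a whole vector lets one closure lemma serve every
    arity. *)
Definition recursive_on (k : nat) (F : seq nat -> nat) : Prop :=
  exists c, forall v, size v = k -> reval c v (F v).

Lemma revals_proj (v : seq nat) :
  revals [seq RProj i | i <- iota 0 (size v)] v v.
Proof.
suff gen s : revals [seq RProj i | i <- s] v [seq nth 0 v i | i <- s].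
  have := gen (iota 0 (size v)); rewrite map_nth_iota0 ?take_size //.
by elim: s => [|i s IH] /=; constructor=> //; constructor.
Qed.

Lemma recursive_on1 (a : nat -> nat) :
  recursive1 a <-> recursive_on 1 (fun v => a (nth 0 v 0)).
Proof.
split=> -[c Hc]; exists c; last by move=> k; apply: (Hc [:: k]).
by case=> [//|x [|//]] _ /=; apply: Hc.
Qed.

Lemma recursive_on2 (a : nat -> nat -> nat) :
  recursive2 a <-> recursive_on 2 (fun v => a (nth 0 v 0) (nth 0 v 1)).
Proof.
split=> -[c Hc]; exists c; last by move=> n k; apply: (Hc [:: n; k]).
by case=> [//|x [//|y [|//]]] _ /=; apply: Hc.
Qed.

Lemma recursive_on_proj k i : recursive_on k (fun v => nth 0 v i).
Proof. by exists (RProj i) => v _; constructor. Qed.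

Lemma recursive_on_comp1 k F f :
  recursive1 F -> recursive_on k f -> recursive_on k (fun v => F (f v)).
Proof.
move=> [c Hc] [d Hd]; exists (RComp c [:: d]) => v Hv.
apply: (@re_comp _ _ _ [:: f v]) => //.
by constructor; [apply: Hd | constructor].
Qed.

Lemma recursive_on_comp2 k F f g :
  recursive2 F -> recursive_on k f -> recursive_on k g ->
  recursive_on k (fun v => F (f v) (g v)).
Proof.
move=> [c Hc] [d Hd] [e He]; exists (RComp c [:: d; e]) => v Hv.
apply: (@re_comp _ _ _ [:: f v; g v]) => //.
constructor; first exact: Hd.
by constructor; [apply: He | constructor].
Qed.

Lemma recursive_on_succ k f :
  recursive_on k f -> recursive_on k (fun v => (f v).+1).
Proof.
apply: recursive_on_comp1; exists RSucc => n; exact: (re_succ [:: n]).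
Qed.

Lemma recursive_on_const k n : recursive_on k (fun=> n).
Proof.
elim: n => [|n IH]; last exact: recursive_on_succ.
by exists RZero => v _; constructor.
Qed.

(** [RPrec] runs its step on the counter, the previous value and the parameters, in this order;
    hence the arity [k.+2] and the [drop 2 v] that recovers the parameters. *)
Lemma recursive_on_rec k f G N :
  recursive_on k f -> recursive_on k.+2 (fun v => G (nth 0 v 0) (nth 0 v 1) (drop 2 v)) ->
  recursive_on k N ->
  recursive_on k (fun v => nat_rect (fun=> nat) (f v) (fun n z => G n z v) (N v)).
Proof.
move=> [c Hc] [d Hd] [e He].
exists (RComp (RPrec c d) (e :: [seq RProj i | i <- iota 0 k])) => v Hv.
apply: (@re_comp _ _ _ (N v :: v)).
  by constructor; [apply: He | rewrite -Hv; apply: revals_proj].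
elim: (N v) => [|n IH] /=; first by constructor; apply: Hc.
apply: (re_precS IH).
by have := Hd [:: n, nat_rect (fun=> nat) (f v) (fun n z => G n z v) n & v];
  rewrite /= drop0; apply; rewrite Hv.
Qed.

Lemma recursive_on_min k f F :
  recursive_on k.+1 f ->
  (forall v, size v = k -> f (F v :: v) = 0 /\ forall j, j < F v -> f (j :: v) <> 0) ->
  recursive_on k F.
Proof.
move=> [c Hc] HF; exists (RMin c) => v Hv; have [H0 H1] := HF v Hv.
constructor; first by rewrite -H0; apply: Hc; rewrite /= Hv.
(* [re_min] asks for each earlier value as an explicit successor, whence the predecessor as
   witness. *)
move=> j jF; exists (f (j :: v)).-1.
by rewrite prednK ?lt0n; [apply: Hc; rewrite /= Hv | apply/eqP/H1].
Qed.

(** * Recursiveness of the arithmetic operations *)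

Lemma recursive2_add : recursive2 addn.
Proof.
apply/recursive_on2.
have := @recursive_on_rec 2 (fun v => nth 0 v 1) (fun _ z _ => z.+1) (fun v => nth 0 v 0)
  (recursive_on_proj _ _) (recursive_on_succ _ _ (recursive_on_proj _ _)) (recursive_on_proj _ _).
by congr recursive_on; apply/funext => v; elim: (nth 0 v 0) => //= n ->.
Qed.

Lemma recursive_on_add k f g :
  recursive_on k f -> recursive_on k g -> recursive_on k (fun v => f v + g v).
Proof. exact: recursive_on_comp2 recursive2_add. Qed.

Lemma nth0_drop2 i (v : seq nat) : nth 0 (drop 2 v) i = nth 0 v i.+2.
Proof. by rewrite nth_drop add2n. Qed.

Lemma recursive2_mul : recursive2 muln.
Proof.
apply/recursive_on2.
have := @recursive_on_rec 2 (fun=> 0) (fun _ z v => nth 0 v 1 + z) (fun v => nth 0 v 0)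
  (recursive_on_const _ _) _ (recursive_on_proj _ _).
rewrite (_ : (fun v => nat_rect _ _ _ _) = fun v => nth 0 v 0 * nth 0 v 1).
  apply; apply: recursive_on_add; last exact: recursive_on_proj.
  by under eq_fun do rewrite nth0_drop2; apply: recursive_on_proj.
by apply/funext => v; elim: (nth 0 v 0) => //= n ->; rewrite mulSn.
Qed.

Lemma recursive_on_mul k f g :
  recursive_on k f -> recursive_on k g -> recursive_on k (fun v => f v * g v).
Proof. exact: recursive_on_comp2 recursive2_mul. Qed.

Lemma recursive_on_pred k f :
  recursive_on k f -> recursive_on k (fun v => (f v).-1).
Proof.
apply: recursive_on_comp1; apply/recursive_on1.
have := @recursive_on_rec 1 (fun=> 0) (fun n _ _ => n) (fun v => nth 0 v 0)
  (recursive_on_const _ _) (recursive_on_proj _ _) (recursive_on_proj _ _).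
by congr recursive_on; apply/funext => v; case: (nth 0 v 0).
Qed.

Lemma recursive2_sub : recursive2 subn.
Proof.
apply/recursive_on2.
have := @recursive_on_rec 2 (fun v => nth 0 v 0) (fun _ z _ => z.-1) (fun v => nth 0 v 1)
  (recursive_on_proj _ _) (recursive_on_pred _ _ (recursive_on_proj _ _)) (recursive_on_proj _ _).
congr recursive_on; apply/funext => v; elim: (nth 0 v 1) => [|n IH] /=; first by rewrite subn0.
by rewrite IH subnS.
Qed.

Lemma recursive_on_sub k f g :
  recursive_on k f -> recursive_on k g -> recursive_on k (fun v => f v - g v).
Proof. exact: recursive_on_comp2 recursive2_sub. Qed.

(** * Pairs and lists coded as natural numbers *)

Definition npair (a b : nat) : nat := (a + b) * (a + b) + a.

Lemma nroot_ex z : exists s, z < s.+1 * s.+1.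
Proof. by exists z; nia. Qed.

Definition nroot (z : nat) : nat := ex_minn (nroot_ex z).

Definition nfst (z : nat) : nat := z - nroot z * nroot z.
Definition nsnd (z : nat) : nat := nroot z - nfst z.

(** Since [a < 2 * (a + b) + 1], the code lies between the squares of [a + b] and [a + b + 1]. So
    the integer square root recovers the sum, and the excess over its square recovers [a]. *)
Lemma nroot_npair a b : nroot (npair a b) = a + b.
Proof.
rewrite /nroot /npair; case: ex_minnP => s Hs Hmin.
have := Hmin (a + b); have : ~~ (s < a + b) -> s >= a + b by lia.
have [lt|] := ltnP s (a + b); first by nia.
by move=> ? _ H; have := H ltac:(nia); lia.
Qed.

Lemma nfst_npair a b : nfst (npair a b) = a.
Proof. by rewrite /nfst nroot_npair /npair; lia. Qed.

Lemma nsnd_npair a b : nsnd (npair a b) = b.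
Proof. by rewrite /nsnd nfst_npair nroot_npair; lia. Qed.

Lemma npair_inj a b c d : npair a b = npair c d -> a = c /\ b = d.
Proof.
move=> E; rewrite -(nfst_npair a b) -{2}(nsnd_npair a b) E.
by rewrite nfst_npair nsnd_npair.
Qed.

Lemma recursive_on_npair k f g :
  recursive_on k f -> recursive_on k g -> recursive_on k (fun v => npair (f v) (g v)).
Proof.
move=> Hf Hg; apply: recursive_on_add => //.
by apply: recursive_on_mul; apply: recursive_on_add.
Qed.

Lemma recursive_on_nroot k f :
  recursive_on k f -> recursive_on k (fun v => nroot (f v)).
Proof.
apply: recursive_on_comp1; apply/recursive_on1.
(* By truncated subtraction, [z.+1 - s.+1 * s.+1] vanishes exactly when [z < s.+1 * s.+1], so
   minimization finds the root. *)
apply: (@recursive_on_min _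
  (fun v => (nth 0 v 1).+1 - (nth 0 v 0).+1 * (nth 0 v 0).+1)).
  apply: recursive_on_sub; last apply: recursive_on_mul;
  by apply: recursive_on_succ; apply: recursive_on_proj.
move=> v _ /=; rewrite /nroot; case: ex_minnP => s Hs Hmin; split; first lia.
by move=> j js; have := Hmin j; lia.
Qed.

Lemma recursive_on_nfst k f :
  recursive_on k f -> recursive_on k (fun v => nfst (f v)).
Proof.
move=> Hf; apply: recursive_on_sub => //.
by apply: recursive_on_mul; apply: recursive_on_nroot.
Qed.

Lemma recursive_on_nsnd k f :
  recursive_on k f -> recursive_on k (fun v => nsnd (f v)).
Proof.
move=> Hf; apply: recursive_on_sub; first exact: recursive_on_nroot.
exact: recursive_on_nfst.
Qed.

(** The successor keeps nonempty lists apart from 0, the code of the empty list. *)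
Definition lcons (x l : nat) : nat := (npair x l).+1.

Fixpoint nlist (l : seq nat) : nat :=
  if l is x :: l' then lcons x (nlist l') else 0.

Definition nnth (l i : nat) : nat := nfst (iter i (fun l => nsnd l.-1) l).-1.

Lemma lcons_inj x l y k : lcons x l = lcons y k -> x = y /\ l = k.
Proof. by case=> /npair_inj. Qed.

Lemma nroot0 : nroot 0 = 0. Proof. exact: (nroot_npair 0 0). Qed.

Lemma nnth_nlist l i : nnth (nlist l) i = nth 0 l i.
Proof.
(* As 0 decodes to two zeros, iterated tails stay at 0 past the end, in agreement with the default
   of [nth 0]. *)
have [f0 s0] : nfst 0 = 0 /\ nsnd 0 = 0 by rewrite /nsnd /nfst nroot0.
rewrite /nnth; elim: l i => [|x l IH] i.
  rewrite nth_nil (_ : iter _ _ _ = 0) //.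
  by elim: i => //= i ->.
by case: i => [|i]; rewrite ?iterSr /= ?nfst_npair ?nsnd_npair ?IH.
Qed.

Lemma recursive_on_nnth k f g :
  recursive_on k f -> recursive_on k g -> recursive_on k (fun v => nnth (f v) (g v)).
Proof.
move=> Hf Hg; apply: recursive_on_nfst; apply: recursive_on_pred.
have := @recursive_on_rec k f (fun _ z _ => nsnd z.-1) g Hf _ Hg.
rewrite (_ : (fun v => nat_rect _ _ _ _) = fun v => iter (g v) (fun l => nsnd l.-1) (f v)).
  apply; apply: recursive_on_nsnd; apply: recursive_on_pred; exact: recursive_on_proj.
by apply/funext => v; elim: (g v) => //= n ->.
Qed.

(** * Recursive predicates under the assumption that Sigma_1 sets are decidable *)

Definition sigma1_decidable : Prop :=
  forall h : nat -> nat -> nat, recursive2 h ->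
  exists2 d, recursive1 d & forall n, d n = 0 <-> exists t, h n t = 0.

Lemma recursive1_comp1 F f :
  recursive1 F -> recursive1 f -> recursive1 (fun e => F (f e)).
Proof.
move=> HF /recursive_on1 Hf; apply/recursive_on1; exact: recursive_on_comp1 HF Hf.
Qed.

Lemma recursive1_id : recursive1 (fun e => e).
Proof. by apply/recursive_on1; apply: recursive_on_proj. Qed.

Lemma recursive1_const n : recursive1 (fun=> n).
Proof. by apply/recursive_on1; apply: recursive_on_const. Qed.

Lemma recursive1_succ f : recursive1 f -> recursive1 (fun e => (f e).+1).
Proof.
by move=> /recursive_on1 Hf; apply/recursive_on1; apply: recursive_on_succ.
Qed.

Lemma recursive1_sub f g :
  recursive1 f -> recursive1 g -> recursive1 (fun e => f e - g e).
Proof.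
move=> /recursive_on1 Hf /recursive_on1 Hg.
by apply/recursive_on1; apply: recursive_on_sub.
Qed.

Lemma recursive1_add f g :
  recursive1 f -> recursive1 g -> recursive1 (fun e => f e + g e).
Proof.
move=> /recursive_on1 Hf /recursive_on1 Hg.
by apply/recursive_on1; apply: recursive_on_add.
Qed.

Lemma recursive1_mul f g :
  recursive1 f -> recursive1 g -> recursive1 (fun e => f e * g e).
Proof.
move=> /recursive_on1 Hf /recursive_on1 Hg.
by apply/recursive_on1; apply: recursive_on_mul.
Qed.

Lemma recursive1_npair f g :
  recursive1 f -> recursive1 g -> recursive1 (fun e => npair (f e) (g e)).
Proof.
move=> /recursive_on1 Hf /recursive_on1 Hg.
by apply/recursive_on1; apply: recursive_on_npair.
Qed.

Lemma recursive1_lcons f g :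
  recursive1 f -> recursive1 g -> recursive1 (fun e => lcons (f e) (g e)).
Proof. by move=> Hf Hg; apply: recursive1_succ; apply: recursive1_npair. Qed.

Lemma recursive1_nnth f g :
  recursive1 f -> recursive1 g -> recursive1 (fun e => nnth (f e) (g e)).
Proof.
move=> /recursive_on1 Hf /recursive_on1 Hg.
by apply/recursive_on1; apply: recursive_on_nnth.
Qed.

Lemma recursive1_nfst f : recursive1 f -> recursive1 (fun e => nfst (f e)).
Proof.
by move=> /recursive_on1 Hf; apply/recursive_on1; apply: recursive_on_nfst.
Qed.

Lemma recursive1_nsnd f : recursive1 f -> recursive1 (fun e => nsnd (f e)).
Proof.
by move=> /recursive_on1 Hf; apply/recursive_on1; apply: recursive_on_nsnd.
Qed.

Ltac solve_recursive :=
  repeat first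
  [ assumption | apply: recursive1_id | apply: recursive1_const
  | apply: recursive1_lcons | apply: recursive1_npair | apply: recursive1_nnth
  | apply: recursive1_nfst | apply: recursive1_nsnd
  | apply: recursive1_succ
  | match goal with H : recursive1 ?f |- recursive1 (fun e => ?f _) =>
      apply: (recursive1_comp1 _ _ H) end ].

(** Zero stands for truth, so conjunction becomes a sum, disjunction a product and negation
    [1 - d]. *)
Definition recursive_pred (P : nat -> Prop) : Prop :=
  exists2 d, recursive1 d & forall e, d e = 0 <-> P e.

Lemma recursive_pred_eq f g :
  recursive1 f -> recursive1 g -> recursive_pred (fun e => f e = g e).
Proof.
move=> Hf Hg; exists (fun e => (f e - g e) + (g e - f e)); last by lia.
by apply: recursive1_add; apply: recursive1_sub.
Qed.

Lemma recursive_pred_lt f g :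
  recursive1 f -> recursive1 g -> recursive_pred (fun e => f e < g e).
Proof.
move=> Hf Hg; exists (fun e => (f e).+1 - g e); last by lia.
by apply: recursive1_sub => //; apply: recursive1_succ.
Qed.

Lemma recursive_pred_and P Q :
  recursive_pred P -> recursive_pred Q -> recursive_pred (fun e => P e /\ Q e).
Proof.
move=> [c Hc cP] [d Hd dQ]; exists (fun e => c e + d e); first exact: recursive1_add.
by move=> e; rewrite -cP -dQ; lia.
Qed.

Lemma recursive_pred_or P Q :
  recursive_pred P -> recursive_pred Q -> recursive_pred (fun e => P e \/ Q e).
Proof.
move=> [c Hc cP] [d Hd dQ]; exists (fun e => c e * d e); first exact: recursive1_mul.
by move=> e; rewrite -cP -dQ; nia.
Qed.

Lemma recursive_pred_not P :
  recursive_pred P -> recursive_pred (fun e => ~ P e).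
Proof.
move=> [c Hc cP]; exists (fun e => 1 - c e); last by move=> e; rewrite -cP; lia.
by apply: recursive1_sub => //; apply: recursive1_const.
Qed.

Lemma recursive_pred_iff P Q :
  (forall e, P e <-> Q e) -> recursive_pred P -> recursive_pred Q.
Proof. by move=> PQ [d Hd dP]; exists d => // e; rewrite dP. Qed.

Lemma recursive_pred_imply P Q :
  recursive_pred P -> recursive_pred Q -> recursive_pred (fun e => P e -> Q e).
Proof.
move=> HP HQ.
apply: (recursive_pred_iff (fun e => ~ P e \/ Q e)); last first.
  by apply: recursive_pred_or => //; apply: recursive_pred_not.
by move=> e; split=> [[]//|PQ]; have [/PQ|] := pselect (P e); [right|left].
Qed.

(** The bound variable is packed with the parameter by [npair]; predicates stay unary, so
    quantifiers can be nested to any depth. *)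
Lemma recursive_pred_ex P : sigma1_decidable ->
  recursive_pred (fun p => P (nfst p) (nsnd p)) ->
  recursive_pred (fun e => exists t, P t e).
Proof.
move=> H1 [d Hd dP]; have [|c Hc cP] := H1 (fun n t => d (npair t n)).
  apply/recursive_on2; apply: recursive_on_comp1 => //.
  by apply: recursive_on_npair; apply: recursive_on_proj.
exists c => // e; rewrite cP; split=> -[t Pt]; exists t.
  by move/dP: Pt; rewrite nfst_npair nsnd_npair.
by apply/dP; rewrite nfst_npair nsnd_npair.
Qed.

Lemma recursive_pred_all P : sigma1_decidable ->
  recursive_pred (fun p => P (nfst p) (nsnd p)) ->
  recursive_pred (fun e => forall t, P t e).
Proof.
move=> H1 HP.
apply: (recursive_pred_iff (fun e => ~ exists t, ~ P t e)); last first.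
  by apply: recursive_pred_not; apply: (recursive_pred_ex _ H1); apply: recursive_pred_not.
move=> e; split=> [nP t|aP [t]]; last by apply.
by apply: contrapT => nPt; apply: nP; exists t.
Qed.

(** * Arithmetization of programs and evaluations *)

Fixpoint code_rcode (c : rcode) : nat :=
  match c with
  | RZero => npair 0 0
  | RSucc => npair 1 0
  | RProj i => npair 2 i
  | RComp f gs =>
      npair 3 (npair (code_rcode f)
        ((fix code_list gs := if gs is g :: gs' then
            npair 7 (npair (code_rcode g) (code_list gs')) else npair 6 0) gs))
  | RPrec f g => npair 4 (npair (code_rcode f) (code_rcode g))
  | RMin f => npair 5 (code_rcode f)
  end.

(** A named copy of the fixpoint nested in [code_rcode], where the recursion passes through the list
    of subprograms; the two agree by conversion. *)
Fixpoint code_rcodes (gs : list rcode) : nat :=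
  if gs is g :: gs' then npair 7 (npair (code_rcode g) (code_rcodes gs')) else npair 6 0.

Lemma code_rcode_comp f gs :
  code_rcode (RComp f gs) = npair 3 (npair (code_rcode f) (code_rcodes gs)).
Proof. by []. Qed.

(* Tags 6 and 7 code lists of programs, so this one rule set covers both [reval] and [revals]
   (whose output is then a coded list). *)
Definition reval_step (S : nat -> nat -> nat -> Prop) (c v y : nat) : Prop :=
  (c = npair 0 0 /\ y = 0) \/
  (c = npair 1 0 /\ y = (nnth v 0).+1) \/
  (exists i, c = npair 2 i /\ y = nnth v i) \/
  (exists f gs w, c = npair 3 (npair f gs) /\ S gs v w /\ S f w y) \/
  (exists f g u, c = npair 4 (npair f g) /\ v = lcons 0 u /\ S f u y) \/
  (exists f g n u z, c = npair 4 (npair f g) /\ v = lcons n.+1 u /\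
     S c (lcons n u) z /\ S g (lcons n (lcons z u)) y) \/
  (exists f, c = npair 5 f /\ S f (lcons y v) 0 /\
     forall k, k < y -> exists z, S f (lcons k v) z.+1) \/
  (c = npair 6 0 /\ y = 0) \/
  (exists g gs z w, c = npair 7 (npair g gs) /\ S g v z /\ S gs v w /\ y = lcons z w).

(** The successor keeps judgements distinct from 0, the value of [nnth] past the end of a coded
    list. *)
Definition judgement (c v y : nat) : nat := (npair c (npair v y)).+1.

Definition nmem_before (s i c v y : nat) : Prop :=
  exists k, k < i /\ nnth s k = judgement c v y.

(** Premises must occur strictly earlier, which makes derivations well founded. Entries that are not
    judgements, in particular those past the end of a coded list, impose nothing, so [i] may range
    over all numbers. *)
Definition derivation (s : nat) : Prop :=
  forall i c v y, nnth s i = judgement c v y -> reval_step (nmem_before s i) c v y.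

Definition coded_reval (c v y : nat) : Prop :=
  exists s, derivation s /\ exists i, nnth s i = judgement c v y.

(** Unfolded, the relation is a first-order formula over recursive terms. Each connective and
    quantifier is removed by its closure lemma, the quantifiers at the price of
    [sigma1_decidable]. *)
Lemma recursive_coded_reval (c v y : nat -> nat) :
  sigma1_decidable -> recursive1 c -> recursive1 v -> recursive1 y ->
  recursive_pred (fun e => coded_reval (c e) (v e) (y e)).
Proof.
move=> H1 Hc Hv Hy.
rewrite /coded_reval /derivation /reval_step /nmem_before /judgement.
repeat first [ apply: recursive_pred_and | apply: recursive_pred_or
  | apply: (recursive_pred_ex _ H1) | apply: recursive_pred_eq
  | apply: recursive_pred_lt
  | apply: recursive_pred_imply
  | apply: (recursive_pred_all _ H1) ].
all: solve_recursive.
Qed.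

(** * Induction over evaluations, and determinism *)

Section RevalInduction.
Context (P : rcode -> list nat -> nat -> Prop) (Q : list rcode -> list nat -> list nat -> Prop).
Context (Pzero : forall v, P RZero v 0).
Context (Psucc : forall v, P RSucc v (nth 0 v 0).+1).
Context (Pproj : forall i v, P (RProj i) v (nth 0 v i)).
Context (Pcomp : forall f gs v w y, Q gs v w -> P f w y -> P (RComp f gs) v y).
Context (Pprec0 : forall f g v y, P f v y -> P (RPrec f g) (0 :: v) y).
Context (PprecS : forall f g n v z y,
  P (RPrec f g) (n :: v) z -> P g [:: n, z & v] y -> P (RPrec f g) (n.+1 :: v) y).
Context (Pmin : forall f v n, P f (n :: v) 0 ->
  (forall k, k < n -> exists y, P f (k :: v) y.+1) -> P (RMin f) v n).
Context (Qnil : forall v, Q [::] v [::]).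
Context (Qcons : forall g gs v y w, P g v y -> Q gs v w -> Q (g :: gs) v (y :: w)).

(* Rocq's [Scheme] gives no induction hypothesis under the [exists] of [re_min]. *)
Fixpoint reval_mutual_ind c v y (H : reval c v y) {struct H} : P c v y :=
  match H in reval c v y return P c v y with
  | re_zero v => Pzero v
  | re_succ v => Psucc v
  | re_proj i v => Pproj i v
  | @re_comp f gs v w y Hgs Hf =>
      Pcomp f gs v w y (revals_mutual_ind gs v w Hgs) (reval_mutual_ind f w y Hf)
  | @re_prec0 f g v y Hf => Pprec0 f g v y (reval_mutual_ind _ _ _ Hf)
  | @re_precS f g n v z y Hr Hg =>
      PprecS f g n v z y (reval_mutual_ind _ _ _ Hr) (reval_mutual_ind _ _ _ Hg)
  | @re_min f v n H0 Hk => Pmin f v n (reval_mutual_ind _ _ _ H0)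
      (fun k kn => match Hk k kn with
                   | ex_intro y Hy => ex_intro _ y (reval_mutual_ind _ _ _ Hy)
                   end)
  end
with revals_mutual_ind gs v w (H : revals gs v w) {struct H} : Q gs v w :=
  match H in revals gs v w return Q gs v w with
  | res_nil v => Qnil v
  | @res_cons g gs v y w Hg Hgs =>
      Qcons g gs v y w (reval_mutual_ind _ _ _ Hg) (revals_mutual_ind _ _ _ Hgs)
  end.
End RevalInduction.

Lemma reval_inj c v y : reval c v y -> forall y', reval c v y' -> y = y'.
Proof.
move: c v y.
apply: (reval_mutual_ind (fun c v y => forall y', reval c v y' -> y = y')
  (fun gs v w => forall w', revals gs v w' -> w = w')).
- by move=> v y' H; inversion H.
- by move=> v y' H; inversion H.
- by move=> i v y' H; inversion H.
- by move=> f gs v w y IHgs IHf y' H; inversion H; subst; apply: IHf; rewrite (IHgs w0).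
- by move=> f g v y IH y' H; inversion H; subst; apply: IH.
- move=> f g n v z y IHz IHy y' H; inversion H; subst.
  by apply: IHy; rewrite (IHz z0).
- move=> f v n IH0 IHk n' H; inversion H as [| | | | | |f' v' n0 H0 Hk]; subst.
  (* If one search stopped earlier, its stopping point would evaluate to 0 in one run and to a
     successor in the other. *)
  have [lt|lt|//] := ltngtP n n'.
    by have [y Hy] := Hk _ lt; have := IH0 _ Hy.
  by have [y Hy] := IHk _ lt; have := Hy _ H0.
- by move=> v w' H; inversion H.
- by move=> g gs v y w IHg IHgs w' H; inversion H; subst; f_equal; [apply: IHg | apply: IHgs].
Qed.

(** * Soundness and completeness of coded derivations *)

Lemma judgement_inj c v y c' v' y' :
  judgement c v y = judgement c' v' y' -> [/\ c = c', v = v' & y = y'].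
Proof. by case=> /npair_inj [-> /npair_inj [-> ->]]. Qed.

(** Premises occur only positively in the rules. This carries a rule application over to a longer
    list of available judgements. *)
Lemma reval_step_mono (S T : nat -> nat -> nat -> Prop) c v y :
  (forall c v y, S c v y -> T c v y) -> reval_step S c v y -> reval_step T c v y.
Proof.
move=> ST; rewrite /reval_step.
case=> [?|]; first tauto. case=> [?|]; first tauto. case=> [?|]; first tauto.
case=> [[f [gs [w [? [/ST ? /ST ?]]]]]|].
  by do 3 right; left; exists f, gs, w.
case=> [[f [g [u [? [? /ST ?]]]]]|].
  by do 4 right; left; exists f, g, u.
case=> [[f [g [n [u [z [? [? [/ST ? /ST ?]]]]]]]]|].
  by do 5 right; left; exists f, g, n, u, z.
case=> [[f [? [/ST ? Hk]]]|].
  do 6 right; left; exists f; do 2 split=> //.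
  by move=> k /Hk [z /ST]; exists z.
case=> [?|]; first tauto.
case=> [g [gs [z [w [? [/ST ? [/ST ? ?]]]]]]].
by do 8 right; exists g, gs, z, w.
Qed.

(** Strong induction on the position, premises being earlier entries. Programs and lists of programs
    are treated together because [RComp] leads from the former to the latter. *)
Lemma derivation_sound s i : derivation s ->
  (forall c v y, nnth s i = judgement (code_rcode c) (nlist v) y -> reval c v y) /\
  (forall gs v y, nnth s i = judgement (code_rcodes gs) (nlist v) y ->
     exists2 w, y = nlist w & revals gs v w).
Proof.
move=> ds; elim/ltn_ind: i => i IH.
have IH1 c v y : nmem_before s i (code_rcode c) (nlist v) y -> reval c v y.
  by case=> k [ki]; apply: (IH k ki).1.
have IH2 gs v y : nmem_before s i (code_rcodes gs) (nlist v) y ->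
    exists2 w, y = nlist w & revals gs v w.
  by case=> k [ki]; apply: (IH k ki).2.
split.
- case=> [||j'|f' gs'|f' g'|f'] v y /ds; rewrite /reval_step ?code_rcode_comp;
  move=> [[ec ->]|[[ec ->]|[[j [ec ->]]|[[f [gs [w [ec [Sgs Sf]]]]]
   |[[f [g [u [ec [ev Sf]]]]]|[[f [g [n [u [z [ec [ev [Sz Sg]]]]]]]]
   |[[f [ec [S0 Sk]]]|[[ec ->]|[g [gs [z [w [ec [Sg [Sgs ->]]]]]]]]]]]]]]];
  (* Comparing tags leaves, for each constructor, only the rules bearing its tag. *)
  move: ec; try by move=> /npair_inj [].
+ by constructor.
+ by rewrite nnth_nlist; constructor.
+ by move=> /npair_inj [_ ->]; rewrite nnth_nlist; constructor.
+ move=> /npair_inj [_ /npair_inj [ef egs]]; subst f gs.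
  by have [w' ew Hw] := IH2 _ _ _ Sgs; subst w; apply: (re_comp Hw); apply: IH1.
+ move=> /npair_inj [_ /npair_inj [ef eg]]; subst f g.
  case: v ev => [//|x v /lcons_inj [-> eu]]; subst u.
  by constructor; apply: IH1.
+ move=> ec; have /npair_inj [_ /npair_inj [ef eg]] := ec; subst f g.
  case: v ev => [//|x v /lcons_inj [-> eu]]; subst u.
  apply: re_precS (IH1 _ [:: n, z & v] _ Sg).
  by apply: IH1; exact: Sz.
+ move=> /npair_inj [_ ef]; subst f.
  constructor; first by apply: (IH1 _ (y :: v)).
  by move=> k /Sk [z Sz]; exists z; apply: (IH1 _ (k :: v)).
- case=> [|g' gs'] v y /ds; rewrite /reval_step;
  move=> [[ec ->]|[[ec ->]|[[j [ec ->]]|[[f [hs [w [ec [Sgs Sf]]]]]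
   |[[f [g [u [ec [ev Sf]]]]]|[[f [g [n [u [z [ec [ev [Sz Sg]]]]]]]]
   |[[f [ec [S0 Sk]]]|[[ec ->]|[g [hs [z [w [ec [Sg [Sgs ->]]]]]]]]]]]]]]];
  move: ec; try by move=> /npair_inj [].
+ by exists [::] => //; constructor.
+ move=> /npair_inj [_ /npair_inj [eg egs]]; subst g hs.
  have [w' ew Hw] := IH2 _ _ _ Sgs; subst w; exists (z :: w') => //.
  by constructor=> //; apply: IH1.
Qed.

Definition listed (L : seq nat) (c v y : nat) : Prop := judgement c v y \in L.

Lemma nmem_before_nlist L i c v y :
  nmem_before (nlist L) i c v y <-> listed (take i L) c v y.
Proof.
rewrite /nmem_before /listed; split=> [[k [ki]]|].
  rewrite nnth_nlist => E; rewrite -E.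
  have kL : k < size L by rewrite ltnNge; apply/negP => ?; rewrite nth_default in E.
  by rewrite -(nth_take 0 ki); apply: mem_nth; rewrite size_take; case: ifP.
move=> /(nthP 0) [k]; rewrite size_take => kL E.
have ki : k < i by apply: leq_trans kL _; case: ltnP.
by exists k; split=> //; rewrite nnth_nlist -E nth_take.
Qed.

(** Entries of [L1] keep their prefix; entries of [L2] see their old prefix enlarged by [L1]. *)
Lemma derivation_cat L1 L2 :
  derivation (nlist L1) -> derivation (nlist L2) -> derivation (nlist (L1 ++ L2)).
Proof.
move=> d1 d2 i c v y; rewrite nnth_nlist nth_cat.
have [lti|lei] := ltnP i (size L1); rewrite -nnth_nlist.
  move=> /d1; apply: reval_step_mono => {}c {}v {}y.
  by rewrite !nmem_before_nlist take_cat lti.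
move=> /d2; apply: reval_step_mono => {}c {}v {}y.
by rewrite !nmem_before_nlist take_cat ltnNge lei /= /listed mem_cat => ->; rewrite orbT.
Qed.

Lemma derivation_rcons L c v y : derivation (nlist L) ->
  reval_step (listed L) c v y -> derivation (nlist (rcons L (judgement c v y))).
Proof.
move=> dL st i c' v' y'; rewrite nnth_nlist nth_rcons.
have [lti|lti|->] := ltngtP i (size L) => //.
  rewrite -nnth_nlist => /dL; apply: reval_step_mono => {}c' {}v' {}y'.
  by rewrite !nmem_before_nlist -cats1 take_cat lti.
move=> /judgement_inj [<- <- <-]; apply: reval_step_mono st => {}c' {}v' {}y'.
by rewrite nmem_before_nlist -cats1 take_size_cat.
Qed.

(** Stated over actual lists rather than codes, so that derivations of several premises can be
    concatenated. *)
Definition derivable (c v y : nat) : Prop :=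
  exists2 L, derivation (nlist L) & listed L c v y.

Lemma derivable_coded_reval c v y : derivable c v y -> coded_reval c v y.
Proof.
move=> [L dL]; exists (nlist L); split=> //; exists (index (judgement c v y) L).
by rewrite nnth_nlist nth_index.
Qed.

Lemma derivable_step L c v y :
  derivation (nlist L) -> reval_step (listed L) c v y -> derivable c v y.
Proof.
move=> dL st; exists (rcons L (judgement c v y)); first exact: derivation_rcons.
by rewrite /listed mem_rcons mem_head.
Qed.

Lemma derivation_nil : derivation (nlist [::]).
Proof. by move=> i c v y; rewrite nnth_nlist nth_nil. Qed.

Lemma derivable_join c v y c' v' y' : derivable c v y -> derivable c' v' y' ->
  exists L, [/\ derivation (nlist L), listed L c v y & listed L c' v' y'].
Proof.
move=> [L1 d1 m1] [L2 d2 m2]; exists (L1 ++ L2); split; first exact: derivation_cat.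
  by rewrite /listed mem_cat m1.
by rewrite /listed mem_cat m2 orbT.
Qed.

(** Induction on the evaluation: the derivations of the premises are concatenated and the conclusion
    is appended. *)
Lemma reval_derivable c v y : reval c v y -> derivable (code_rcode c) (nlist v) y.
Proof.
move: c v y.
apply: (reval_mutual_ind (fun c v y => derivable (code_rcode c) (nlist v) y)
  (fun gs v w => derivable (code_rcodes gs) (nlist v) (nlist w))).
- by move=> v; apply: derivable_step derivation_nil _; left.
- move=> v; apply: derivable_step derivation_nil _.
  by right; left; rewrite nnth_nlist.
- move=> i v; apply: derivable_step derivation_nil _.
  by do 2 right; left; exists i; rewrite nnth_nlist.
- move=> f gs v w y Dgs Df; have [L [dL m1 m2]] := derivable_join _ _ _ _ _ _ Dgs Df.
  apply: (derivable_step L) => //; do 3 right; left.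
  by exists (code_rcode f), (code_rcodes gs), (nlist w); rewrite code_rcode_comp.
- move=> f g v y [L dL m]; apply: (derivable_step L) => //; do 4 right; left.
  by exists (code_rcode f), (code_rcode g), (nlist v).
- move=> f g n v z y Dz Dy; have [L [dL m1 m2]] := derivable_join _ _ _ _ _ _ Dz Dy.
  apply: (derivable_step L) => //; do 5 right; left.
  by exists (code_rcode f), (code_rcode g), n, (nlist v), z.
- move=> f v n [L0 dL0 m0] Dk.
  (* The finitely many derivations for [k < n] are merged into one list by induction on [n]. *)
  have [L dL mL] : exists2 L, derivation (nlist L) &
      forall k, k < n -> exists z, listed L (code_rcode f) (nlist (k :: v)) z.+1.
    elim: n Dk {m0} => [|n IH] Dk; first by exists [::] => //; apply: derivation_nil.
    have [|L dL mL] := IH; first by move=> k kn; apply: Dk; apply: ltnW.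
    have [z [L' dL' mL']] := Dk n (ltnSn n).
    exists (L ++ L'); first exact: derivation_cat.
    move=> k; rewrite ltnS leq_eqVlt => /predU1P [->|/mL [z' Hz']].
      by exists z; rewrite /listed mem_cat mL' orbT.
    by exists z'; rewrite /listed mem_cat Hz'.
  apply: (derivable_step (L0 ++ L)); first exact: derivation_cat.
  do 6 right; left; exists (code_rcode f); split=> //; split.
    by rewrite /listed mem_cat m0.
  by move=> k /mL [z Hz]; exists z; rewrite /listed mem_cat Hz orbT.
- by move=> v; apply: derivable_step derivation_nil _; do 7 right; left.
- move=> g gs v y w Dg Dgs; have [L [dL m1 m2]] := derivable_join _ _ _ _ _ _ Dg Dgs.
  apply: (derivable_step L) => //; do 8 right.
  by exists (code_rcode g), (code_rcodes gs), y, (nlist w).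
Qed.

Lemma coded_revalP c v y : coded_reval (code_rcode c) (nlist v) y <-> reval c v y.
Proof.
split=> [[s [ds [i si]]]|/reval_derivable/derivable_coded_reval //].
exact: (derivation_sound s i ds).1.
Qed.

(** Diagonalization: under the assumption some program [c] computes a [d] with [d e = 0] exactly
    when the program coded by [e] does not return 0 on [e]. Running [c] on its own code is
    contradictory. *)
Theorem sigma1_undecidable : ~ sigma1_decidable.
Proof.
move=> H1.
have : recursive_pred (fun e => coded_reval e (lcons e 0) 0).
  apply: recursive_coded_reval => //; first exact: recursive1_id.
    by apply: recursive1_lcons; [apply: recursive1_id | apply: recursive1_const].
  exact: recursive1_const.
move=> /recursive_pred_not [d [c Hc] dP].
have := dP (code_rcode c); rewrite (coded_revalP c [:: code_rcode c]).
(* The value 0 contradicts the choice of [d] at once; a successor value excludes the output 0 by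
   determinism, which forces [d] to be 0 there. *)
have Hk := Hc (code_rcode c); case: (d _) Hk => [|n] Hk [d0 d1]; first exact: d0.
suff : n.+1 = 0 by [].
by apply: d1 => H0; have := reval_inj _ _ _ Hk _ H0.
Qed.

(** * Computable real sequences from recursive functions *)

Local Open Scope ring_scope.

(** This turns a bounded search into a zero test of a single product, a recursive function of the
    bound. *)
Lemma prod_ord_eq0 (h : nat -> nat) k :
  (\prod_(t < k) h t)%N = 0%N <-> exists2 t, (t < k)%N & h t = 0%N.
Proof.
elim: k => [|k IH]; first by rewrite big_ord0; split=> [|[]].
rewrite big_ord_recr /=; split=> [/eqP|[t]].
  rewrite muln_eq0 => /orP[/eqP/IH [t tk ht]|/eqP hk]; last by exists k.
  by exists t => //; apply: ltnW.
rewrite ltnS leq_eqVlt => /predU1P [->|tk] ht; first by rewrite ht muln0.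
by rewrite (IH.2 _) ?mul0n //; exists t.
Qed.

Lemma recursive_on_prod k h f g : recursive2 h -> recursive_on k f -> recursive_on k g ->
  recursive_on k (fun v => \prod_(t < g v) h (f v) t)%N.
Proof.
move=> Hh; apply: (recursive_on_comp2 _ (fun n k => \prod_(t < k) h n t)%N).
apply/recursive_on2.
have := @recursive_on_rec 2 (fun=> 1%N) (fun t z v => (z * h (nth 0%N v 0) t)%N)
  (fun v => nth 0%N v 1) (recursive_on_const _ _) _ (recursive_on_proj _ _).
rewrite (_ : (fun v => nat_rect _ _ _ _) = fun v => (\prod_(t < nth 0 v 1) h (nth 0 v 0) t)%N).
  apply; apply: recursive_on_mul; first exact: recursive_on_proj.
  apply: recursive_on_comp2 => //; last exact: recursive_on_proj.
  by under eq_fun do rewrite nth0_drop2; apply: recursive_on_proj.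
apply/funext => v; elim: (nth 0%N v 1) => [|n IH]; first by rewrite big_ord0.
by rewrite big_ord_recr /= IH.
Qed.

Section Reduction.
Variable R : realType.
Implicit Types (h : nat -> nat -> nat) (x y : nat -> R).

(* [2 ^ minn t0 k], where [t0] is the least zero of [h n] (infinite if there is none) *)
Definition halt_denom h (n k : nat) : nat :=
  nat_rect (fun=> nat) 1%N
    (fun j b => b * (2 - (1 - \prod_(t < j.+1) h n t)))%N k.

Lemma recursive_halt_denom h : recursive2 h -> recursive2 (halt_denom h).
Proof.
move=> Hh; apply/recursive_on2.
apply: (@recursive_on_rec 2 (fun=> 1%N)
  (fun j b v => b * (2 - (1 - \prod_(t < j.+1) h (nth 0 v 0) t)))%N
  (fun v => nth 0%N v 1)); try exact: recursive_on_const; try exact: recursive_on_proj.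
apply: recursive_on_mul; first exact: recursive_on_proj.
do 2 (apply: recursive_on_sub; first exact: recursive_on_const).
apply: recursive_on_prod => //.
  by under eq_fun do rewrite nth0_drop2; apply: recursive_on_proj.
by apply: recursive_on_succ; apply: recursive_on_proj.
Qed.

Lemma halt_denom_never h n k :
  (forall t, (t < k)%N -> h n t <> 0%N) -> halt_denom h n k = (2 ^ k)%N.
Proof.
elim: k => //= k IH nz.
have IH' := IH (fun t tk => nz t (ltnW tk)).
rewrite /halt_denom /= -/(halt_denom h n k) IH' expnSr; congr (_ * _)%N.
(* By truncated subtraction, the newest factor of the denominator is 2 for a nonzero product and 1
   for a zero one. *)
have : (\prod_(t < k.+1) h n t)%N <> 0%N by move=> /prod_ord_eq0 [t /nz].
by case: (\prod_(t < k.+1) h n t)%N.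
Qed.

(** From stage [t0] on every product contains the factor [h n t0 = 0], so the denominator stops
    doubling. *)
Lemma halt_denom_least h n t0 k : h n t0 = 0%N ->
  (forall t, (t < t0)%N -> h n t <> 0%N) -> halt_denom h n k = (2 ^ minn t0 k)%N.
Proof.
move=> h0 nz; elim: k => [|k IH]; first by rewrite minn0.
have [lt|ge] := ltnP k t0.
  rewrite (minn_idPr lt) halt_denom_never // => t tk; apply: nz; lia.
rewrite /halt_denom /= -/(halt_denom h n k) IH.
have -> : (\prod_(t < k.+1) h n t)%N = 0%N by apply/prod_ord_eq0; exists t0.
by rewrite muln1; congr (2 ^ _)%N; lia.
Qed.

Definition halt_real h (x : R) n :=
  (exists2 t, h n t = 0%N & x = (2 ^+ t)^-1) \/ ((forall t, h n t <> 0%N) /\ x = 0).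

Lemma computable_halt_seq h : recursive2 h ->
  exists x, [/\ computable_seq x, forall n, 0 <= x n <= 1 & forall n, halt_real h (x n) n].
Proof.
move=> Hh.
have /choice [x Hx] n : exists x : R, halt_real h x n /\
    forall k, `|(halt_denom h n k)%:R^-1 - x| <= (2 ^+ k)^-1.
  have p2 j : 0 < (2 ^+ j : R)^-1 by rewrite invr_gt0 exprn_gt0.
  have [[t /eqP ht]|nex] := pselect (exists t, h n t = 0%N); last first.
    have nz t : h n t <> 0%N by move=> ?; apply: nex; exists t.
    exists 0; split; first by right.
    by move=> k; rewrite halt_denom_never // natrX subr0 ger0_norm // ltW.
  have := @ex_minnP (fun t => h n t == 0%N) (ex_intro _ t ht).
  case=> t0 /eqP h0 tmin; exists (2 ^+ t0)^-1; split; first by left; exists t0.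
  move=> k; rewrite (halt_denom_least _ _ t0) //; last first.
    by move=> j jt /eqP /tmin; rewrite leqNgt jt.
  (* Once [t0 <= k] the approximation is exact; before that both numbers are positive and at most
     [(2 ^+ k)^-1], which therefore bounds their difference. *)
  rewrite natrX; have [le|/ltnW le] := leqP t0 k; first by rewrite subrr normr0 ltW.
  have : (2 ^+ t0 : R)^-1 <= (2 ^+ k)^-1.
    by rewrite lef_pV2 ?posrE ?exprn_gt0 // ler_weXn2l // ler1n.
  by move=> H; rewrite ger0_norm ?subr_ge0 // lerBlDr lerDl ltW.
exists x; split; last by move=> n; exact: (Hx n).1.
- exists (fun _ _ => 1%N), (halt_denom h), (fun _ _ => 0%N); split.
  + by apply/recursive_on2; apply: recursive_on_const.
  + exact: recursive_halt_denom.
  + by apply/recursive_on2; apply: recursive_on_const.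
  + move=> n k; rewrite /halt_denom; elim: k => //= k IH.
    case: (\prod_(t < k.+1) h n t)%N => [|p]; lia.
  + by move=> n k; rewrite /ratval expr0 !mul1r; exact: (Hx n).2.
- move=> n; case: (Hx n).1 => [[t _ ->]|[_ ->]]; last by rewrite lexx ler01.
  by rewrite invr_ge0 exprn_ge0 //= invf_le1 ?exprn_gt0 // exprn_ege1 // ler1n.
Qed.

Lemma norm_ratval s a b : `|ratval R s a b| = a%:R / b%:R.
Proof. by rewrite /ratval -mulrA normrMsign ger0_norm // divr_ge0. Qed.

(** If [x n = (2 ^+ t)^-1] then [t < 2 ^+ t = (x n)^-1]. An approximation of [y n] within 1 thus
    bounds [t] by its numerator plus [1 + K], and the search for a zero of [h n] becomes bounded. *)
Lemma no_computable_near_inverse :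
  (forall x, computable_seq x -> (forall n, 0 <= x n <= 1) ->
     exists y K, computable_seq y /\ forall n, `|y n - (x n)^-1| <= K) -> False.
Proof.
move=> Hinv; apply: sigma1_undecidable => h Hh.
have [x [cx x01 hx]] := computable_halt_seq h Hh.
have [y [K [[a [b [s [ra rb rs b0 Hr]]]] yK]]] := Hinv x cx x01.
(* The absolute value supplies the nonnegativity that [archi_boundP] asks for. *)
pose N := Num.bound `|K|.
have bound n t : h n t = 0%N -> x n = (2 ^+ t)^-1 -> (t < a n 0 + N.+1)%N.
  move=> _ xn; rewrite -(ltr_nat R).
  have := yK n; rewrite xn invrK => y1; have := Hr n 0%N; rewrite expr0 invr1 => r1.
  have tlt : (t%:R : R) < 2 ^+ t by rewrite -natrX ltr_nat ltn_expl.
  have KN : K < N%:R by apply: le_lt_trans (ler_norm K) _; exact: archi_boundP.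
  have : `|ratval R (s n 0%N) (a n 0%N) (b n 0%N)| <= (a n 0%N)%:R.
    rewrite norm_ratval ler_pdivrMr ?ltr0n ?lt0n; last exact/eqP.
    by rewrite ler_peMr // ler1n lt0n; apply/eqP.
  rewrite natrD -natr1; move: r1 y1; rewrite !ler_norml; set r := ratval _ _ _ _.
  by move=> /andP[? ?] /andP[? ?] /andP[? ?]; lra.
exists (fun n => \prod_(t < a n 0 + N.+1) h n t)%N.
  apply/recursive_on1; apply: recursive_on_prod => //; first exact: recursive_on_proj.
  apply: recursive_on_add; last exact: recursive_on_const.
  by apply: recursive_on_comp2 => //; [apply: recursive_on_proj | apply: recursive_on_const].
move=> n; split=> [/prod_ord_eq0 [t _ ht]|[t ht]]; first by exists t.
apply/prod_ord_eq0; case: (hx n) => [[t0 h0 xn]|[nz _]]; last by case: (nz t).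
by exists t0 => //; apply: bound.
Qed.

(** At precision index 2 the rational approximation is within 1/4 of [y n], hence within
    [c + 1/4 < 1/2] of the 0/1 indicator. Comparing its modulus with 1/2 decides whether [x n] is
    0. *)
Lemma no_computable_zero_test :
  (forall x, computable_seq x -> (forall n, 0 <= x n <= 1) ->
     exists y c, [/\ computable_seq y, c < 4^-1 &
       forall n, `|y n - (x n == 0)%:R| <= c]) -> False.
Proof.
move=> Htest; apply: sigma1_undecidable => h Hh.
have [x [cx x01 hx]] := computable_halt_seq h Hh.
have [y [c [[a [b [s [ra rb rs b0 Hr]]]] c4 yc]]] := Htest x cx x01.
(* This vanishes exactly when [2a < b], that is, when the modulus [a / b] is below 1/2. *)
exists (fun n => (a n 2 + a n 2).+1 - b n 2)%N.
  apply/recursive_on1; apply: recursive_on_sub.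
    apply: recursive_on_succ; apply: recursive_on_add;
    by apply: recursive_on_comp2 => //; [apply: recursive_on_proj | apply: recursive_on_const].
  by apply: recursive_on_comp2 => //; [apply: recursive_on_proj | apply: recursive_on_const].
move=> n.
have bpos : 0 < (b n 2)%:R :> R by rewrite ltr0n lt0n; apply/eqP.
have rE : `|ratval R (s n 2%N) (a n 2%N) (b n 2%N)| < 2^-1 <->
    ((a n 2%N + a n 2%N).+1 - b n 2%N = 0)%N.
  rewrite norm_ratval ltr_pdivrMr // mulrC ltr_pdivlMr // mulr_natr mulr2n -natrD ltr_nat.
  by split; lia.
rewrite -rE; have := Hr n 2%N; have := yc n; set r := ratval _ _ _ _ => y1 r1.
have e4 : (2 ^+ 2 : R)^-1 = 4^-1 by rewrite -natrX.
rewrite e4 in r1.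
case: (hx n) => [[t ht xn]|[nz xn]]; split.
- by exists t.
- move=> _; move: y1; rewrite xn invr_eq0 expf_eq0 pnatr_eq0 andbF subr0.
  move: r1; rewrite !ler_norml ltr_norml => /andP[? ?] /andP[? ?]; apply/andP; split; lra.
- have {}y1 : `|y n - 1| <= c by move: y1; rewrite xn eqxx.
  move=> rlt; exfalso; move: y1 r1 rlt; rewrite !ler_norml ltr_norml.
  by move=> /andP[? ?] /andP[? ?] /andP[? ?]; lra.
- by case=> t /nz.
Qed.

End Reduction.

(** * Diagonal test matrices *)

Section PseudoInverse.
Context {R : realType}.

Lemma ctrmx_mul m n p (A : 'M[R[i]]_(m, n)) (B : 'M[R[i]]_(n, p)) :
  ctrmx (A *m B) = ctrmx B *m ctrmx A.
Proof. by rewrite /ctrmx map_mxM trmx_mul. Qed.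

(** Inserting [A = AYA] gives [AX = (AY)(AX)]; adjoints reverse the product, so
    [AX = (AX)(AY) = AY]. Likewise [XA = YA], and then [X = XAX = YAX = YAY = Y]. *)
Lemma penrose_unique m n (A : 'M[R[i]]_(m, n)) (X Y : 'M[R[i]]_(n, m)) :
  penrose A X -> penrose A Y -> X = Y.
Proof.
move=> [AXA XAX AXh XAh] [AYA YAY AYh YAh].
have eAX : A *m X = A *m Y.
  have E : A *m X = A *m Y *m (A *m X) by rewrite mulmxA AYA.
  by have := congr1 (@ctrmx _ _ _) E; rewrite AXh ctrmx_mul AXh AYh mulmxA AXA.
have eXA : X *m A = Y *m A.
  have E : X *m A = X *m A *m (Y *m A) by rewrite -mulmxA [A *m _]mulmxA AYA.
  by have := congr1 (@ctrmx _ _ _) E; rewrite XAh ctrmx_mul XAh YAh -mulmxA [A *m _]mulmxA AXA.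
by rewrite -XAX eXA -mulmxA eAX mulmxA YAY.
Qed.

Lemma mp_pinv_eq m n (A : 'M[R[i]]_(m, n)) (X : 'M[R[i]]_(n, m)) :
  penrose A X -> mp_pinv A = X.
Proof.
by move=> AX; apply: xget_unique => // Y AY; apply: penrose_unique AY AX.
Qed.

(** Reduces an error bound in norm to one for a single real entry, to which the scalar reduction
    applies. *)
Lemma norm_Re_entry_le m n (A : 'M[R[i]]_(m, n)) i j :
  `|complex.Re (A i j)| <= frob_norm A.
Proof.
have csq_ge0 (z : R[i]) : 0 <= csqnorm z by rewrite addr_ge0 ?sqr_ge0.
rewrite -sqrtr_sqr; apply: ler_wsqrtr; rewrite (bigD1 i) //= (bigD1 j) //=.
rewrite {1}/csqnorm -!addrA lerDl !addr_ge0 ?sqr_ge0 ?sumr_ge0 // => k _.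
by rewrite sumr_ge0.
Qed.

Lemma frob_norm_ge0 m n (A : 'M[R[i]]_(m, n)) : 0 <= frob_norm A.
Proof. exact: sqrtr_ge0. Qed.

(** The fixed entry 1 keeps the Frobenius norm at least 1 even for [x = 0], so multiplying by it
    does not spoil the growth of the pseudoinverse. *)
Definition diag2 m n (x : R) : 'M[R[i]]_(m.+2, n.+2) :=
  delta_mx 0 0 + real_complex R x *: delta_mx 1 1.

Definition unit2 m : 'cV[R[i]]_m.+2 := delta_mx 1 0.

Lemma diag2E m n x i j : diag2 m n x i j =
  real_complex R (((i == 0) && (j == 0))%:R + x *+ ((i == 1) && (j == 1))).
Proof.
rewrite !mxE rmorphD rmorph_nat rmorphMn /=.
by rewrite mulr_natr.
Qed.

Lemma diag2_mul m n p x y : diag2 m n x *m diag2 n p y = diag2 m p (x * y).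
Proof.
rewrite /diag2 mulmxDl !mulmxDr -!scalemxAl -!scalemxAr !mul_delta_mx.
by rewrite !mul_delta_mx_0 // !scaler0 addr0 add0r scalerA rmorphM.
Qed.

Lemma ctrmx_diag2 m n x : ctrmx (diag2 m n x) = diag2 n m x.
Proof.
apply/matrixP => i j; rewrite 2!mxE !diag2E conjc_real.
by rewrite andbC [(j == 1) && _]andbC.
Qed.

Lemma mp_pinv_diag2 m n x : mp_pinv (diag2 m n x) = diag2 n m x^-1.
Proof.
apply: mp_pinv_eq; rewrite /penrose !diag2_mul !ctrmx_diag2.
(* The convention [0^-1 = 0] is what the pseudoinverse requires at [x = 0]. *)
have [->|x0] := eqVneq x 0; first by rewrite invr0 !mul0r.
by rewrite mulfV // mulVf // !mul1r.
Qed.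

Lemma sum_single m n (a : 'I_m) (b : 'I_n) (c : R) :
  \sum_i \sum_j c *+ ((i == a) && (j == b)) = c.
Proof.
rewrite (bigD1 a) //= (bigD1 b) //= !eqxx big1 => [|j /negbTE ->]; last by rewrite andbF.
by rewrite big1 ?addr0 // => i /negbTE ->; rewrite big1.
Qed.

Lemma frob_norm_diag2 m n x : frob_norm (diag2 m n x) = Num.sqrt (1 + x ^+ 2).
Proof.
congr Num.sqrt; rewrite -[1 in RHS](sum_single m.+2 n.+2 0 0).
rewrite -[x ^+ 2](sum_single m.+2 n.+2 1 1) -big_split; apply: eq_bigr => i _.
rewrite -big_split; apply: eq_bigr => j _; rewrite diag2E /csqnorm /= expr0n addr0.
(* The two diagonal positions are distinct, so squaring an entry produces no cross term. *)
have : ~~ (((i == 0) && (j == 0)) && ((i == 1) && (j == 1))).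
  by case: eqVneq => // ->; rewrite andbF.
move: ((i == 0) && (j == 0)) ((i == 1) && (j == 1)) => [] [] //= _;
  by rewrite ?mulr0n ?mulr1n ?addr0 ?add0r ?expr1n ?expr0n.
Qed.

Lemma vnorm_scale_unit2 m x : vnorm (real_complex R x *: unit2 m) = `|x|.
Proof.
rewrite -sqrtr_sqr; congr Num.sqrt; rewrite -[RHS](sum_single m.+2 1 1 0).
apply: eq_bigr => i _; apply: eq_bigr => j _; rewrite !mxE /csqnorm.
by case: (_ && _); rewrite /= ?mulr0 ?mulr1 ?mulr0n ?mulr1n /=; ring.
Qed.

Lemma vnorm_unit2 m : vnorm (unit2 m) = 1.
Proof. by rewrite -[unit2 m]scale1r (vnorm_scale_unit2 m 1) normr1. Qed.

Lemma diag2_unit2 m n x : diag2 m n x *m unit2 n = real_complex R x *: unit2 m.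
Proof.
by rewrite mulmxDl -scalemxAl mul_delta_mx mul_delta_mx_0 // add0r.
Qed.

(** * Least-squares residual of the test problem *)

Lemma lsq_res_min m n (A : 'M[R[i]]_(m, n)) b x0 :
  (forall x, vnorm (A *m x0 - b) <= vnorm (A *m x - b)) ->
  lsq_res A b = vnorm (A *m x0 - b).
Proof.
move=> Hmin; apply/eqP; rewrite eq_le; apply/andP; split.
  by apply: ge_inf; [exists 0 => _ [x ->]; apply: frob_norm_ge0 | exists x0].
by apply: lb_le_inf; [exists (vnorm (A *m x0 - b)), x0 | move=> _ [x ->]].
Qed.

Lemma lsq_res_diag2 m n x : lsq_res (diag2 m n x) (unit2 m) = (x == 0)%:R.
Proof.
have [->|x0] := eqVneq x 0.
  rewrite (@lsq_res_min _ _ _ _ 0) mulmx0 sub0r -scaleN1r.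
    by rewrite -[-1](rmorphN1 (real_complex R)) vnorm_scale_unit2 normrN1.
  move=> y; rewrite -[-1](rmorphN1 (real_complex R)) vnorm_scale_unit2 normrN1.
  (* For [x = 0] row 1 of the matrix vanishes, so entry 1 of every residual is -1 and the norm is at
     least 1. *)
  apply: le_trans (norm_Re_entry_le _ _ _ 1 0); rewrite !mxE big1 => [|k _].
    by rewrite !eqxx /= add0r mulr0 subr0 mulr1 normrN1.
  by rewrite diag2E mul0rn addr0 /= mul0r.
(* For nonzero [x] this vector solves the system exactly. *)
rewrite (@lsq_res_min _ _ _ _ (real_complex R x^-1 *: unit2 n)).
  by rewrite -scalemxAr diag2_unit2 scalerA -rmorphM mulVf // scale1r subrr
    -(scale0r (unit2 m)) (vnorm_scale_unit2 m 0) normr0.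
move=> y; rewrite -scalemxAr diag2_unit2 scalerA -rmorphM mulVf // scale1r subrr.
by rewrite -(scale0r (unit2 m)) (vnorm_scale_unit2 m 0) normr0 frob_norm_ge0.
Qed.

(** * Computability of the test data *)

Lemma computable_seq_const (c : nat) : computable_seq (fun=> c%:R : R).
Proof.
exists (fun _ _ => c), (fun _ _ => 1%N), (fun _ _ => 0%N).
split=> //; try by apply/recursive_on2; apply: recursive_on_const.
by move=> n k; rewrite /ratval expr0 mul1r divr1 subrr normr0 invr_ge0 exprn_ge0.
Qed.

Lemma computable_diag2_seq m n (x : nat -> R) :
  computable_seq x -> computable_mx_seq (fun k => diag2 m n (x k)).
Proof.
move=> cx i j; split; last first.
  rewrite (_ : (fun k => _) = fun=> 0%:R); first exact: computable_seq_const.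
  by apply/funext => k; rewrite diag2E.
have [ij|/negbTE ij] := boolP ((i == 1) && (j == 1)).
  rewrite (_ : (fun k => _) = x) //; apply/funext => k; rewrite diag2E ij mulr1n.
  by have /andP[/eqP -> _] := ij; rewrite /= add0r.
rewrite (_ : (fun k => _) = fun=> ((i == 0) && (j == 0))%:R).
  exact: computable_seq_const.
by apply/funext => k; rewrite diag2E ij mulr0n addr0.
Qed.

Lemma computable_unit2_seq m : computable_mx_seq (fun=> unit2 m).
Proof.
move=> i j; rewrite !mxE.
by case: (_ && _); split; rewrite /=;
  first [apply: (computable_seq_const 1) | apply: (computable_seq_const 0)].
Qed.
End PseudoInverse.

(** * Norm estimates for the test data *)

Section Bounds.
Context {R : realType}.

Lemma frob_norm_diag2_le m n (x : R) : 0 <= x <= 1 -> frob_norm (diag2 m n x) <= Num.sqrt 2.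
Proof.
move=> /andP[x0 x1]; rewrite frob_norm_diag2 ler_wsqrtr // -[leRHS]/(1 + 1) lerD2l.
by rewrite expr_le1.
Qed.

Lemma vnorm_unit2_le m : vnorm (unit2 m : 'cV[R[i]]_m.+2) <= Num.sqrt 2.
Proof. by rewrite vnorm_unit2 -[leLHS]sqrtr1 ler_wsqrtr // ler1n. Qed.

(** With [u = x^-1] this places the Frobenius norm of the pseudoinverse within 1 of [x^-1]; the
    upper bound is [1 + u^2 <= (1 + u)^2]. *)
Lemma sqrt_1Dsqr_bounds (u : R) : 0 <= u ->
  [/\ 1 <= Num.sqrt (1 + u ^+ 2), u <= Num.sqrt (1 + u ^+ 2) & Num.sqrt (1 + u ^+ 2) <= 1 + u].
Proof.
move=> u0; split.
- by rewrite -[leLHS]sqrtr1 ler_wsqrtr // lerDl sqr_ge0.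
- by rewrite -{1}(ger0_norm u0) -sqrtr_sqr ler_wsqrtr // lerDr.
- have v0 : 0 <= 1 + u by rewrite addr_ge0.
  by rewrite -[leRHS](ger0_norm v0) -sqrtr_sqr ler_wsqrtr //; nra.
Qed.
End Bounds.

Theorem theorem3p3 (R : realType) (m n : nat) (hm : (2 <= m)%N) (hn : (2 <= n)%N) :
  (* (i) *)
  (forall g : 'M[R[i]]_(m, n) -> 'M[R[i]]_(n, m),
     (exists C : R, forall A : 'M[R[i]]_(m, n),
        frob_norm A <= Num.sqrt 2 -> frob_norm (mp_pinv A - g A) <= C) ->
     ~ BM_mx_mx g) /\
  (* (ii) *)
  (forall g : 'M[R[i]]_(m, n) -> R,
     (exists C : R, forall A : 'M[R[i]]_(m, n),
        frob_norm A <= Num.sqrt 2 -> `| frob_norm (mp_pinv A) - g A | <= C) ->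
     ~ BM_mx_real g) /\
  (* (iii) *)
  (forall Psi : 'M[R[i]]_(m, n) -> 'cV[R[i]]_m -> R,
     (exists c : R, c < 4^-1 /\
        forall (A : 'M[R[i]]_(m, n)) (b : 'cV[R[i]]_m),
          frob_norm A <= Num.sqrt 2 -> vnorm b <= Num.sqrt 2 ->
          `| lsq_res A b - Psi A b | <= c) ->
     ~ BM_mxvec_real Psi) /\
  (* (iv) *)
  (forall Psi : 'M[R[i]]_(m, n) -> 'cV[R[i]]_m -> 'cV[R[i]]_n,
     (exists C : R, forall (A : 'M[R[i]]_(m, n)) (b : 'cV[R[i]]_m),
          frob_norm A <= Num.sqrt 2 -> vnorm b <= Num.sqrt 2 ->
          vnorm (mp_pinv A *m b - Psi A b) <= C) ->
     ~ BM_mxvec_vec Psi) /\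
  (* (v) *)
  (forall Psi : 'M[R[i]]_(m, n) -> 'cV[R[i]]_m -> R,
     (exists C : R, forall (A : 'M[R[i]]_(m, n)) (b : 'cV[R[i]]_m),
          frob_norm A <= Num.sqrt 2 -> vnorm b <= Num.sqrt 2 ->
          `| vnorm (mp_pinv A *m b) - Psi A b | <= C) ->
     ~ BM_mxvec_real Psi) /\
  (* (vi) *)
  (forall kappa : 'M[R[i]]_(m, n) -> R,
     (exists C : R, forall A : 'M[R[i]]_(m, n),
        frob_norm A <= Num.sqrt 2 -> `| frob_norm A * frob_norm (mp_pinv A) - kappa A | <= C) ->
     ~ BM_mx_real kappa).
Proof.
case: m hm => [|[|m]] // _; case: n hn => [|[|n]] // _.
(* Here [z] is the exact quantity, [y] its assumed approximation and [u] the scalar [x^-1]. *)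
have near (y z u K L : R) : `|z - y| <= K -> `|z - u| <= L -> `|y - u| <= K + L.
  by move=> yz zu; apply: le_trans (ler_distD z _ _) _; rewrite lerD // distrC.
split; [|split; [|split; [|split; [|split]]]].
- move=> g [C HC] BM; apply: (@no_computable_near_inverse R) => x cx x01.
  (* Entry (1, 1) of the pseudoinverse is exactly [(x k)^-1], so the constant [C] is kept. *)
  exists (fun k => complex.Re (g (diag2 m n (x k)) 1 1)), C; split.
    exact: (BM _ (computable_diag2_seq m n x cx) 1 1).1.
  move=> k; apply: le_trans (HC _ (frob_norm_diag2_le m n _ (x01 k))).
  apply: le_trans (norm_Re_entry_le _ _ _ 1 1).
  rewrite mp_pinv_diag2 mxE [X in _ <= `|complex.Re (_ + X)|]mxE diag2E.
  by rewrite raddfB /= mulr1n add0r distrC.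
- move=> g [C HC] BM; apply: (@no_computable_near_inverse R) => x cx x01.
  exists (fun k => g (diag2 m n (x k))), (C + 1); split.
    exact: BM (computable_diag2_seq m n x cx).
  move=> k; apply: near (HC _ (frob_norm_diag2_le m n _ (x01 k))) _.
  rewrite mp_pinv_diag2 frob_norm_diag2.
  have /andP[xk0 _] := x01 k.
  have [] := sqrt_1Dsqr_bounds (x k)^-1; first by rewrite invr_ge0.
  by move=> _ ? ?; rewrite ler_norml; apply/andP; split; lra.
- move=> Psi [c [c4 HC]] BM; apply: (@no_computable_zero_test R) => x cx x01.
  exists (fun k => Psi (diag2 m n (x k)) (unit2 m)), c; split=> //.
    exact: BM (computable_diag2_seq m n x cx) (computable_unit2_seq m).
  move=> k; rewrite distrC -(lsq_res_diag2 m n).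
  by apply: HC; [apply: frob_norm_diag2_le | apply: vnorm_unit2_le].
- move=> Psi [C HC] BM; apply: (@no_computable_near_inverse R) => x cx x01.
  (* The minimal-norm solution is [(x k)^-1] times [unit2 n], so its entry 1 is read off. *)
  exists (fun k => complex.Re (Psi (diag2 m n (x k)) (unit2 m) 1 0)), C; split.
    exact: (BM _ _ (computable_diag2_seq m n x cx) (computable_unit2_seq m) 1 0).1.
  move=> k; apply: le_trans (HC _ _ (frob_norm_diag2_le m n _ (x01 k)) (vnorm_unit2_le m)).
  apply: le_trans (norm_Re_entry_le _ _ _ 1 0).
  rewrite mp_pinv_diag2 diag2_unit2 mxE [X in _ <= `|complex.Re (_ + X)|]mxE raddfB !mxE.
  by rewrite eqxx /= mulr1 mulr0 subr0 distrC.
- move=> Psi [C HC] BM; apply: (@no_computable_near_inverse R) => x cx x01.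
  exists (fun k => Psi (diag2 m n (x k)) (unit2 m)), (C + 0); split.
    exact: BM (computable_diag2_seq m n x cx) (computable_unit2_seq m).
  move=> k; apply: near (HC _ _ (frob_norm_diag2_le m n _ (x01 k)) (vnorm_unit2_le m)) _.
  have /andP[xk0 _] := x01 k.
  rewrite mp_pinv_diag2 diag2_unit2 vnorm_scale_unit2 [`|(x k)^-1|]ger0_norm ?invr_ge0 //.
  by rewrite subrr normr0.
- move=> kappa [C HC] BM; apply: (@no_computable_near_inverse R) => x cx x01.
  (* The 3 comes from [(1 + x) * (1 + x^-1) = 1 + x + x^-1 + x * x^-1], where [x] and [x * x^-1] are
     at most 1, also when [x = 0]. *)
  exists (fun k => kappa (diag2 m n (x k))), (C + 3); split.
    exact: BM (computable_diag2_seq m n x cx).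
  move=> k; apply: near (HC _ (frob_norm_diag2_le m n _ (x01 k))) _.
  rewrite mp_pinv_diag2 !frob_norm_diag2.
  have /andP[xk0 xk1] := x01 k.
  have xV0 : 0 <= (x k)^-1 by rewrite invr_ge0.
  have xV1 : x k * (x k)^-1 <= 1.
    by have [->|?] := eqVneq (x k) 0; rewrite ?mul0r ?ler01 // mulfV.
  have [p1 _ pu] := sqrt_1Dsqr_bounds _ xk0; have [q1 qu qu'] := sqrt_1Dsqr_bounds _ xV0.
  set p := Num.sqrt _ in p1 pu *; set q := Num.sqrt _ in q1 qu qu' *.
  have pq1 : (x k)^-1 <= p * q by apply: le_trans qu _; rewrite ler_peMl // (le_trans ler01).
  have pq2 : p * q <= (1 + x k) * (1 + (x k)^-1).
    by apply: ler_pM => //; apply: le_trans ler01 _.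
  by rewrite ler_norml; apply/andP; split; lra.
Qed.
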